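(* Let $(M,\mathfrak F,\Lambda)$ be an integral CASK domain, $M_\infty\subset M$ an open subset invariant under $S^1\subset\mathbb C^\times$ and under the monoid $\mathbb R_{\ge1}\subset\mathbb C^\times$, and $\Omega$ a compatible mutually local variation of BPS structures on $(M_\infty,g_M,\omega_M,\nabla,\xi,\Lambda)$ with $\mathrm{Supp}(\Omega)\subset\mathrm{span}_{\mathbb Z}\{\partial_{y_i}\}$. Consider the lift of $g_{\overline N}$ to an open subset of $\overline M\times\mathbb R_{\rho>0}\times\mathrm{Heis}_{2n+3}(\mathbb R)$ (see context). For $\gamma\in\mathrm{Supp}(\Omega)$ write $\gamma=n_i(\gamma)\partial_{y_i}$, and define $d_i:=\gcd(\{n_i(\gamma)\}_{\gamma\in\mathrm{Supp}(\Omega)})$ for those $i\in\{0,1,\dots,n\}$ such that $\{n_i(\gamma)\}_{\gamma\in\mathrm{Supp}(\Omega)}\ne\{0\}$. If $\Omega\neq0$, then the following proper subgroup of $\mathrm{Heis}_{2n+3}(\mathbb R)$ acts by isometries on the lift of $g_{\overline N}$: $$\Big\{(\widetilde\eta_i,\eta^i,\kappa)\in\mathrm{Heis}_{2n+3}(\mathbb R)\ \Big|\ \eta^i\in\frac{2\pi\mathbb Z}{d_i}\ \text{for those } i=0,1,\dots,n\text{ such that }\{n_i(\gamma)\}_{\gamma\in\mathrm{Supp}(\Omega)}\ne\{0\}\Big\}.$$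
   Context: **CASK domain.** A CASK domain $(M,\mathfrak F)$ is a $\mathbb C^\times$-invariant domain $M\subset\mathbb C^{n+1}\setminus\{0\}$ (coordinates $z^0,\dots,z^n$) with a holomorphic function $\mathfrak F:M\to\mathbb C$ homogeneous of degree $2$ such that $N_{ij}=\mathrm{Im}(\tau_{ij})$, $\tau_{ij}=\partial^2\mathfrak F/\partial z^i\partial z^j$, has signature $(1,n)$ and $N_{ij}z^i\overline z^j>0$ on $M$. Put $w_i=\partial\mathfrak F/\partial z^i$, $x^i=\mathrm{Re}\,z^i$, $y_i=-\mathrm{Re}\,w_i$; $\nabla$ is the connection for which $dx^i,dy_i$ are flat; $g_M=N_{ij}dz^id\overline z^j$, $\omega_M=dx^i\wedge dy_i$, $\xi=z^i\partial_{z^i}+\overline z^i\partial_{\overline z^i}$, $\Lambda=\mathrm{span}_{\mathbb Z}\{\partial_{x^i},\partial_{y_i}\}$; $(M,\mathfrak F,\Lambda)$ is an integral CASK domain. $J$ is the complex structure, $\langle\cdot,\cdot\rangle=\omega_M|_{\Lambda\times\Lambda}$, Darboux frame $(\widetilde\gamma_i,\gamma^i)=(\partial_{x^i},\partial_{y_i})$; the canonical central charge $Z$ has $Z_{\partial_{y_i}}=z^i$, $Z_{\partial_{x^i}}=w_i$. $r^2=N_{ij}z^i\overline z^j$, $\widetilde\eta=r^{-2}g_M(J\xi,\cdot)$. $\overline M=M/\mathbb C^\times$ with coordinates $X^i=z^i/z^0$, $X^0:=1$, $\mathcal K=-\log(N_{ij}X^i\overline X^j)$. **BPS structures.** A mutually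 local variation of BPS structures is $\Omega:\Lambda\to\mathbb Z$, $\mathrm{Supp}(\Omega)=\{\Omega\ne0\}$, with: $\Omega(-\gamma)=\Omega(\gamma)$; $\langle\gamma,\gamma'\rangle=0$ on $\mathrm{Supp}(\Omega)$; the Kontsevich–Soibelman wall-crossing formula (in this case: $\Omega(\gamma)$ locally constant for flat $\gamma$); for compact $K$ and a covariantly constant norm there is $C>0$ with $|Z_\gamma|>C|\gamma|$ for $\gamma\in\Lambda|_K\cap\mathrm{Supp}(\Omega)$; for each $R>0$, $\sum_{\gamma\in\Lambda_p}|\Omega(\gamma)|e^{-R|Z_\gamma|}$ converges normally on compacta. **Hyperkähler structure.** $N:=T^*M_\infty/\Lambda^*$, projection $\pi_M$; $\theta_\gamma([\alpha])=2\pi\alpha(\gamma)$ mod $2\pi$; pullbacks omitted; $\langle dA\wedge dB\rangle:=dA_{\widetilde\gamma_i}\wedge dB_{\gamma^i}-dA_{\gamma^i}\wedge dB_{\widetilde\gamma_i}$. With $K_0,K_1$ modified Bessel functions of the second kind, $$V_\gamma^{\mathrm{inst}}=\frac1{2\pi}\sum_{n>0}e^{in\theta_\gamma}K_0(2\pi n|Z_\gamma|),\quad A_\gamma^{\mathrm{inst}}=-\frac1{4\pi}\sum_{n>0}e^{in\theta_\gamma}|Z_\gamma|K_1(2\pi n|Z_\gamma|)\Big(\frac{dZ_\gamma}{Z_\gamma}-\frac{d\overline Z_\gamma}{\overline Z_\gamma}\Big),$$ $$\omega_1+i\omega_2=-\frac1{2\pi}\langle dZ\wedge d\theta\rangle+\sum_\gamma\Big(\Omega(\gamma)dZ_\gamma\wedge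 A_\gamma^{\mathrm{inst}}+\frac{i\Omega(\gamma)}{2\pi}V_\gamma^{\mathrm{inst}}d\theta_\gamma\wedge dZ_\gamma\Big),$$ $$\omega_3=\frac14\langle dZ\wedge d\overline Z\rangle-\frac1{8\pi^2}\langle d\theta\wedge d\theta\rangle+\sum_\gamma\Big(\frac{i\Omega(\gamma)}2V_\gamma^{\mathrm{inst}}dZ_\gamma\wedge d\overline Z_\gamma+\frac{\Omega(\gamma)}{2\pi}d\theta_\gamma\wedge A_\gamma^{\mathrm{inst}}\Big).$$ Compatible means $T=\pi_M^*g_M+\sum_\gamma\Omega(\gamma)V_\gamma^{\mathrm{inst}}|dZ_\gamma|^2$ is non-degenerate on $TN/\ker d\pi_M$; then $\omega_\alpha=g_N(I_\alpha\cdot,\cdot)$ for a pseudo-hyperkähler structure $(g_N,I_1,I_2,I_3)$, $I_\alpha=-\omega_\beta^{-1}\circ\omega_\gamma$ (cyclic). $V$ is the $\nabla$-horizontal lift of $J\xi$ to $N$ ($d\theta_\gamma(V)=0$), $X:=2V$. **Circle bundle and QK metric.** Identify $T^*M_\infty\cong\Lambda^*\otimes\mathbb R$ by $\alpha\mapsto\theta=2\pi\alpha|_\Lambda$. $P$ is the quotient of $T^*M_\infty\times\mathbb R_\sigma$ by $(2\pi\delta,\pi k)\cdot(\theta,\sigma)=(\theta+2\pi\delta,\sigma+\pi k+\frac12\langle\delta,\theta\rangle)$, $\delta\in\Lambda^*,k\in\mathbb Z$, where $\langle\delta,\theta\rangle=\delta_{\widetilde\gamma_i}\theta_{\gamma^i}-\delta_{\gamma^i}\theta_{\widetilde\gamma_i}$;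 $\pi_N:P\to N$ is a principal circle bundle with generator $\partial_\sigma$. Put $$\eta_\gamma^{\mathrm{inst}}=\frac i{8\pi^2}\sum_{n>0}\frac{e^{in\theta_\gamma}}n|Z_\gamma|K_1(2\pi n|Z_\gamma|)\Big(\frac{dZ_\gamma}{Z_\gamma}-\frac{d\overline Z_\gamma}{\overline Z_\gamma}\Big),\quad\eta^{\mathrm{inst}}=\sum_\gamma\Omega(\gamma)\eta_\gamma^{\mathrm{inst}}-\iota_V(g_N-\pi_M^*g_M),$$ $\eta=d\sigma-\frac1{4\pi}\langle\theta,d\theta\rangle+2\pi(-\frac12r^2\widetilde\eta+\eta^{\mathrm{inst}})$. For a fixed $c\in\mathbb R$: $f=2\pi r^2-c+4\pi\sum_\gamma\Omega(\gamma)\iota_V\eta_\gamma^{\mathrm{inst}}$, $f_1=-2\pi r^2-c+4\pi\iota_V\eta^{\mathrm{inst}}$, $N'=\{f\ne0,f_1\ne0,g_N(X,X)\ne0\}\subset N$. On $P|_{N'}$: $g_P=\frac2{f_1}\eta^2+2\pi g_N$, $\theta_0^P=-\frac12df$, $\theta_1^P=\eta+\frac12\iota_X(2\pi g_N)$, $\theta_2^P=\frac12\iota_X(2\pi\omega_2)$, $\theta_3^P=-\frac12\iota_X(2\pi\omega_1)$, and $g_{\overline N}:=-\frac1f\big(g_P-\frac2f\sum_{i=0}^3(\theta_i^P)^2\big)\big|_{\overline N}$, where $\overline N=\{\mathrm{Arg}(z^0)=0\}\subset P|_{N'}$ is the locus $z^0\in\mathbb R_{>0}$, with coordinates $\rho=2\pi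 r^2-c$, $X^i$ $(1\le i\le n)$, $\widetilde\theta_i=\theta_{\partial_{x^i}}$, $\theta^i=\theta_{\partial_{y_i}}$ $(0\le i\le n)$, $\sigma$. Sums over $\gamma$ run over $\mathrm{Supp}(\Omega)$; repeated indices are summed. **Heisenberg group and lift.** $\mathrm{Heis}_{2n+3}(\mathbb R)=\mathbb R^{2(n+1)+1}$ with elements $(\widetilde\theta_i,\theta^i,\sigma)=(\theta,\sigma)$ and product $(\theta,\sigma)\cdot(\theta',\sigma')=(\theta+\theta',\sigma+\sigma'+\frac1{4\pi}\langle\theta,\theta'\rangle)$, $\langle\theta,\theta'\rangle=\widetilde\theta_i\theta'^i-\theta^i\widetilde\theta'_i$. It acts on $\overline M\times\mathbb R_{\rho>0}\times\mathrm{Heis}_{2n+3}(\mathbb R)$ by left multiplication on the last factor. The lift of $g_{\overline N}$ is obtained by taking the coordinate expression of $g_{\overline N}$ with $(\widetilde\theta_i,\theta^i,\sigma)$ now regarded as global real coordinates on $\mathbb R^{2n+3}$; equivalently it is the pullback of $g_{\overline N}$, on the open set of points mapped into $\overline N$, by the map sending $((X^i),\rho,\theta,\sigma)$ to the class in $P$ of $(\theta,\sigma)$ over the point $z=z^0\cdot(1,X^1,\dots,X^n)$, $z^0=\sqrt{(\rho+c)/2\pi}\,e^{\mathcal K(X)/2}>0$. *)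

(* Defs.v *)
From HB Require Import structures.
From mathcomp Require Import all_boot all_order all_algebra.
From mathcomp Require Import complex.
From mathcomp Require Import all_classical all_reals all_analysis.
From mathcomp Require Import ring.
From mathcomp.analysis.showcase Require Import summability.

Set Implicit Arguments.
Unset Strict Implicit.
Unset Printing Implicit Defensive.
Import Order.TTheory GRing.Theory Num.Theory numFieldNormedType.Exports.
Local Open Scope classical_set_scope.
Local Open Scope ring_scope.
Local Open Scope complex_scope.

(* The complex numbers as a normed space over themselves: [differentiable] and
   ['D_u] on maps between spaces over [CC R] are complex differentiability and
   complex directional derivatives. *)
Notation CC R := (R[i]^o).
Notation cabs := ComplexField.Normc.normc.

Section special_functions.
Context {R : realType}.
Implicit Types x t : R.

Definition cosh t : R := (expR t + expR (- t)) / 2.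

(* The modified Bessel function of the second kind, for x > 0:
   K_nu(x) = int_0^oo exp(- x cosh t) cosh(nu t) dt. *)
Definition besselK (nu : nat) x : R :=
  (\int[lebesgue_measure]_(t in `[0%R, +oo[) (expR (- x * cosh t) * cosh (nu%:R * t)))%R.

Definition expi t : CC R := cos t +i* sin t.

Definition sum_pos (u : nat -> CC R) : CC R := limn (series (fun k => u k.+1)).

End special_functions.

Section cask.
Context {R : realType} {n : nat}.
Implicit Types (F : 'rV[CC R]_n.+1 -> CC R) (z u v : 'rV[CC R]_n.+1).

Definition wfun F (i : 'I_n.+1) z : CC R := 'D_(delta_mx 0 i) F z.

Definition tau F (i j : 'I_n.+1) z : CC R := 'D_(delta_mx 0 i) (wfun F j) z.

Definition Nmx F z : 'M[R]_n.+1 := \matrix_(i, j) complex.Im (tau F i j z).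

(* Real tangent vectors of M are encoded by their dz-components in C^(n+1), and
   g_M = N_ij dz^i d(zbar)^j is the symmetric tensor Re (N_ij u^i (vbar)^j). *)
Definition gM F z u v : R :=
  complex.Re (\sum_i \sum_j (Nmx F z i j)%:C%C * u 0 i * (v 0 j)^*%C).

(* r^2 = N_ij z^i (zbar)^j = g_M(xi, xi); xi and J xi are encoded by z and i z *)
Definition r2 F z : R := gM F z z z.

Definition etatilde F z u : R := (r2 F z)^-1 * gM F z ('i%C *: z) u.

(* A real symmetric matrix has signature (1, n): it is congruent to
   diag(1, -1, ..., -1). *)
Definition signature_1n (A : 'M[R]_n.+1) : Prop :=
  exists2 P : 'M[R]_n.+1, P \in unitmx &
    P *m A *m P^T = diag_mx (\row_i (if i == ord0 then 1 else -1)).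

Record CASK_domain (M : set 'rV[CC R]_n.+1) F : Prop := {
  cask_open : open M ;
  cask_connected : connected M ;
  cask_neq0 : ~ M 0 ;
  cask_invariant : forall (l : CC R) z, l != 0 -> M z -> M (l *: z) ;
  cask_holomorphic : forall z, M z -> differentiable F z ;
  cask_homogeneous : forall (l : CC R) z, l != 0 -> M z ->
    F (l *: z) = l ^+ 2 * F z ;
  cask_signature : forall z, M z -> signature_1n (Nmx F z) ;
  cask_positive : forall z, M z -> 0 < r2 F z }.

Record cask_end (M Minf : set 'rV[CC R]_n.+1) : Prop := {
  end_open : open Minf ;
  end_sub : Minf `<=` M ;
  end_circle : forall (l : CC R) z, cabs l = 1 -> Minf z -> Minf (l *: z) ;
  end_scale : forall (t : R) z, 1 <= t -> Minf z -> Minf (t%:C%C *: z) }.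

End cask.

(* Lambda is trivialised by its global flat frame: the pair (a, b) stands for
   the flat section a^i d/dx^i + b_i d/dy_i. *)
Notation latticeL n := ('rV[int]_n.+1 * 'rV[int]_n.+1)%type.

Section charges.
Context {R : realType} {n : nat}.
Implicit Types (F : 'rV[CC R]_n.+1 -> CC R) (z u : 'rV[CC R]_n.+1).
Implicit Types (g : latticeL n) (M K : set 'rV[CC R]_n.+1).
Implicit Types Omega : 'rV[CC R]_n.+1 -> latticeL n -> int.

Definition gtilde (i : 'I_n.+1) : latticeL n := (delta_mx 0 i, 0).
Definition gup (i : 'I_n.+1) : latticeL n := (0, delta_mx 0 i).

(* omega_M = dx^i /\ dy_i on Lambda *)
Definition pairing g g' : int :=
  \sum_i (g.1 0 i * g'.2 0 i - g.2 0 i * g'.1 0 i).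

Definition Zfun F g z : CC R :=
  \sum_i ((g.1 0 i)%:~R * wfun F i z + (g.2 0 i)%:~R * z 0 i).

(* As Z_g is holomorphic, dZ_g on the real tangent vector encoded by u is the
   complex derivative of Z_g along u. *)
Definition dZfun F g z u : CC R := 'D_u (Zfun F g) z.

Definition is_norm (nu : 'rV[R]_n.+1 * 'rV[R]_n.+1 -> R) : Prop :=
  [/\ forall v w, nu (v + w) <= nu v + nu w,
      forall (a : R) v, nu (a *: v) = `|a| * nu v &
      forall v, nu v = 0 -> v = 0].

Definition chargeR g : 'rV[R]_n.+1 * 'rV[R]_n.+1 :=
  (map_mx intr g.1, map_mx intr g.2).

(* Omega z g is the value of Omega at g in Lambda_z; only z in M matters. *)
Record mutually_local_BPS M F Omega : Prop := {
  bps_sym : forall z g, M z -> Omega z (- g) = Omega z g ;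
  bps_local : forall z g g', M z ->
    Omega z g != 0 -> Omega z g' != 0 -> pairing g g' = 0 ;
  bps_wall_crossing : forall z g, M z ->
    \forall z' \near z, Omega z' g = Omega z g ;
  bps_support : forall K nu, compact K -> K `<=` M -> is_norm nu ->
    exists2 C : R, 0 < C & forall z g, K z -> Omega z g != 0 ->
      C * nu (chargeR g) < cabs (Zfun F g z) ;
  bps_convergence : forall (r : R) K, 0 < r -> compact K -> K `<=` M ->
    (\esum_(g in [set: latticeL n])
       ereal_sup [set (`|Omega z g|%:~R * expR (- r * cabs (Zfun F g z)))%:E
                 | z in K] < +oo)%E }.

Definition Supp M Omega : set (latticeL n) :=
  [set g | exists2 z, M z & Omega z g != 0].

End charges.

(* Real coordinates (Re z, Im z, theta_{d/dx}, theta_{d/dy}) on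
   T^*M_oo = M_oo x R^(2n+2).  All objects on N are handled through their
   pullbacks along the covering T^*M_oo -> N, and tangent vectors through their
   components. *)
Notation dimN n := ((n.+1 + n.+1) + (n.+1 + n.+1))%N.

Section hyperkaehler.
Context {R : realType} {n : nat}.
Variables (F : 'rV[CC R]_n.+1 -> CC R) (Omega : 'rV[CC R]_n.+1 -> latticeL n -> int).
Implicit Types (p u v : 'rV[R]_(dimN n)) (g : latticeL n).

Definition zc p : 'rV[CC R]_n.+1 :=
  \row_j (lsubmx (lsubmx p) 0 j +i* rsubmx (lsubmx p) 0 j)%C.
Definition thtilde p : 'rV[R]_n.+1 := lsubmx (rsubmx p).
Definition thup p : 'rV[R]_n.+1 := rsubmx (rsubmx p).
Definition mkN (z : 'rV[CC R]_n.+1) (a b : 'rV[R]_n.+1) : 'rV[R]_(dimN n) :=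
  row_mx (row_mx (map_mx (@complex.Re R) z) (map_mx (@complex.Im R) z))
         (row_mx a b).

(* theta_g is linear in the coordinates, so that d theta_g (u) = theta g u. *)
Definition theta g p : R :=
  \sum_i ((g.1 0 i)%:~R * thtilde p 0 i + (g.2 0 i)%:~R * thup p 0 i).
Definition dtheta g u : CC R := (theta g u)%:C%C.

Definition dZ g p u : CC R := dZfun F g (zc p) (zc u).
Definition dZbar g p u : CC R := ((dZ g p u)^*)%C.

Definition absZ g p : R := cabs (Zfun F g (zc p)).

Definition dargZ g p u : CC R :=
  dZ g p u / Zfun F g (zc p) - dZbar g p u / ((Zfun F g (zc p))^*)%C.

Definition Vinst g p : CC R :=
  (2 * pi)^-1%:C%C * sum_pos (fun k =>
    expi (k%:R * theta g p) * (besselK 0 (2 * pi * k%:R * absZ g p))%:C%C).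

Definition Ainst g p u : CC R :=
  - (4 * pi)^-1%:C%C * sum_pos (fun k =>
    expi (k%:R * theta g p) * (absZ g p)%:C%C *
    (besselK 1 (2 * pi * k%:R * absZ g p))%:C%C) * dargZ g p u.

Definition etainst_g g p u : CC R :=
  'i%C / (8 * pi ^+ 2)%:C%C * sum_pos (fun k =>
    expi (k%:R * theta g p) / k%:R * (absZ g p)%:C%C *
    (besselK 1 (2 * pi * k%:R * absZ g p))%:C%C) * dargZ g p u.

(* sum over g in Supp(Omega) of Omega(g) t_g at the point p, as an
   unconditional sum; charges outside the support contribute 0. *)
Definition bps_sum p (t : latticeL n -> CC R) : CC R :=
  sum (fun g => (Omega (zc p) g)%:~R * t g).

Definition wedge (a b : 'rV[R]_(dimN n) -> CC R) u v : CC R :=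
  a u * b v - a v * b u.

Definition wedge_pairing (a b : latticeL n -> 'rV[R]_(dimN n) -> CC R) u v : CC R :=
  \sum_i (wedge (a (gtilde i)) (b (gup i)) u v
          - wedge (a (gup i)) (b (gtilde i)) u v).

Definition omega12 p u v : CC R :=
  - (2 * pi)^-1%:C%C * wedge_pairing (fun g => dZ g p) dtheta u v
  + bps_sum p (fun g => wedge (dZ g p) (Ainst g p) u v
      + 'i%C / (2 * pi)%:C%C * Vinst g p * wedge (dtheta g) (dZ g p) u v).

Definition omega1 p u v : R := complex.Re (omega12 p u v).
Definition omega2 p u v : R := complex.Im (omega12 p u v).

(* The expression defining omega_3 is real since Omega(-g) = Omega(g); the same
   holds for the other sums over g below of which the real part is taken. *)
Definition omega3 p u v : R := complex.Re (
  4^-1 * wedge_pairing (fun g => dZ g p) (fun g => dZbar g p) u v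
  - (8 * pi ^+ 2)^-1%:C%C * wedge_pairing dtheta dtheta u v
  + bps_sum p (fun g => 'i%C / 2 * Vinst g p * wedge (dZ g p) (dZbar g p) u v
      + (2 * pi)^-1%:C%C * wedge (dtheta g) (Ainst g p) u v)).

(* The tensor T, on TN / ker d pi_M = T_z M *)
Definition Tform p (u v : 'rV[CC R]_n.+1) : R :=
  gM F (zc p) u v + complex.Re (bps_sum p (fun g =>
    Vinst g p * (complex.Re (dZfun F g (zc p) u * (dZfun F g (zc p) v)^*%C))%:C%C)).

Definition compatible (Minf : set 'rV[CC R]_n.+1) : Prop :=
  forall p, Minf (zc p) ->
  forall u : 'rV[CC R]_n.+1,
    (forall v : 'rV[CC R]_n.+1, Tform p u v = 0) -> u = 0.

(* Matrix of a bilinear form b: b u v = u *m bmx b *m v^T.  Endomorphisms of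
   the tangent space act on row vectors on the right. *)
Definition bmx (b : 'rV[R]_(dimN n) -> 'rV[R]_(dimN n) -> R) : 'M[R]_(dimN n) :=
  \matrix_(i, j) b (delta_mx 0 i) (delta_mx 0 j).

(* I_3 = - omega_1^(-1) o omega_2, where omega_a : u |-> omega_a(u, .) *)
Definition I3mx p : 'M[R]_(dimN n) :=
  - (bmx (omega2 p) *m invmx (bmx (omega1 p))).

(* g_N is determined by omega_3 = g_N(I_3 ., .). *)
Definition gN p u v : R :=
  (u *m (invmx (I3mx p) *m bmx (omega3 p)) *m v^T) 0 0.

Definition gMN p u v : R := gM F (zc p) (zc u) (zc v).

Definition Vvec p : 'rV[R]_(dimN n) := mkN ('i%C *: zc p) 0 0.
Definition Xvec p : 'rV[R]_(dimN n) := 2 *: Vvec p.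

Definition etainst p u : R :=
  complex.Re (bps_sum p (fun g => etainst_g g p u))
  - (gN p (Vvec p) u - gMN p (Vvec p) u).

End hyperkaehler.

Section quaternionic_kaehler.
Context {R : realType} {n : nat}.
Variables (F : 'rV[CC R]_n.+1 -> CC R) (Omega : 'rV[CC R]_n.+1 -> latticeL n -> int).
Variable c : R.
Implicit Types (p : 'rV[R]_(dimN n)).

Definition ffctn p : R :=
  2 * pi * r2 F (zc p) - c
  + 4 * pi * complex.Re (bps_sum Omega p (fun g => etainst_g F g p (Vvec p))).

Definition f1fctn p : R :=
  - (2 * pi) * r2 F (zc p) - c + 4 * pi * etainst F Omega p (Vvec p).

Definition Nprime (Minf : set 'rV[CC R]_n.+1) : set 'rV[R]_(dimN n) :=
  [set p | [/\ Minf (zc p), ffctn p != 0, f1fctn p != 0 &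
               gN F Omega p (Xvec p) (Xvec p) != 0]].

(* Objects on P are handled through their pullbacks along the covering
   T^*M_oo x R_sigma -> P. *)
Implicit Types (q u v : ('rV[R]_(dimN n) * R^o)%type).

Definition etaP q u : R :=
  u.2
  - (4 * pi)^-1 * (\sum_i (thtilde q.1 0 i * thup u.1 0 i
                           - thup q.1 0 i * thtilde u.1 0 i))
  + 2 * pi * (- 2^-1 * r2 F (zc q.1) * etatilde F (zc q.1) (zc u.1)
              + etainst F Omega q.1 u.1).

Definition gP q u v : R :=
  2 / f1fctn q.1 * (etaP q u * etaP q v) + 2 * pi * gN F Omega q.1 u.1 v.1.

(* f is smooth where it matters, so that df(u) = 'D_u f. *)
Definition theta0P q u : R := - 2^-1 * 'D_(u.1) (ffctn : _ -> R^o) q.1.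
Definition theta1P q u : R :=
  etaP q u + 2^-1 * (2 * pi * gN F Omega q.1 (Xvec q.1) u.1).
Definition theta2P q u : R := 2^-1 * (2 * pi * omega2 F Omega q.1 (Xvec q.1) u.1).
Definition theta3P q u : R := - 2^-1 * (2 * pi * omega1 F Omega q.1 (Xvec q.1) u.1).

Definition gQK q u v : R :=
  - (ffctn q.1)^-1 * (gP q u v - 2 / ffctn q.1 *
      (theta0P q u * theta0P q v + theta1P q u * theta1P q v
       + theta2P q u * theta2P q v + theta3P q u * theta3P q v)).

(* For the order of R[i], 0 < z^0 means that z^0 is real and positive. *)
Definition Nbar (Minf : set 'rV[CC R]_n.+1) : set ('rV[R]_(dimN n) * R^o)%type :=
  [set q | Nprime Minf q.1 /\ 0 < zc q.1 0 ord0 :> R[i]].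

End quaternionic_kaehler.

(* ((theta~_i, theta^i), sigma) *)
Definition heis (R : realType) (n : nat) : Type :=
  ('rV[R]_n.+1 * 'rV[R]_n.+1 * R^o)%type.

Section heisenberg.
Context {R : realType} {n : nat}.
Implicit Types a b h : heis R n.

Definition symp (s t : 'rV[R]_n.+1 * 'rV[R]_n.+1) : R :=
  \sum_i (s.1 0 i * t.2 0 i - s.2 0 i * t.1 0 i).

Definition heis_one : heis R n := (0, 0).
Definition heis_mul a b : heis R n :=
  (a.1 + b.1, a.2 + b.2 + (4 * pi)^-1 * symp a.1 b.1).
Definition heis_inv a : heis R n := (- a.1, - a.2).

Lemma sympDl s s' t : symp (s + s') t = symp s t + symp s' t.
Proof.
by rewrite -big_split; apply: eq_bigr => i _; rewrite !mxE !mulrDl opprD addrACA.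
Qed.

Lemma sympDr s t t' : symp s (t + t') = symp s t + symp s t'.
Proof.
by rewrite -big_split; apply: eq_bigr => i _; rewrite !mxE !mulrDr opprD addrACA.
Qed.

Lemma symp0l t : symp 0 t = 0.
Proof. by apply: big1 => i _; rewrite !mxE !mul0r subr0. Qed.

Lemma symp0r s : symp s 0 = 0.
Proof. by apply: big1 => i _; rewrite !mxE !mulr0 subr0. Qed.

Lemma sympxx s : symp s s = 0.
Proof. by apply: big1 => i _; rewrite mulrC subrr. Qed.

Lemma sympNl s t : symp (- s) t = - symp s t.
Proof. by apply/eqP; rewrite -addr_eq0 -sympDl addNr symp0l. Qed.

Lemma sympNr s t : symp s (- t) = - symp s t.
Proof. by apply/eqP; rewrite -addr_eq0 -sympDr addNr symp0r. Qed.

Lemma heis_mulA : associative heis_mul.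
Proof.
move=> a b d; rewrite /heis_mul /=; congr pair; first by rewrite addrA.
by rewrite sympDl sympDr; ring.
Qed.

Lemma heis_mul1 : left_id heis_one heis_mul.
Proof. by case=> s x; rewrite /heis_mul /= symp0l mulr0 addr0 !add0r. Qed.

Lemma heis_mulr1 : right_id heis_one heis_mul.
Proof. by case=> s x; rewrite /heis_mul /= symp0r mulr0 !addr0. Qed.

Lemma heis_mulV : left_inverse heis_one heis_inv heis_mul.
Proof.
by case=> s x; rewrite /heis_mul /= sympNl sympxx oppr0 mulr0 addr0 !addNr.
Qed.

Lemma heis_mulrV : right_inverse heis_one heis_inv heis_mul.
Proof.
by case=> s x; rewrite /heis_mul /= sympNr sympxx oppr0 mulr0 addr0 !subrr.
Qed.

End heisenberg.

HB.instance Definition _ (R : realType) (n : nat) :=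
  Choice.copy (heis R n) ('rV[R]_n.+1 * 'rV[R]_n.+1 * R^o)%type.
HB.instance Definition _ (R : realType) (n : nat) :=
  isGroup.Build (heis R n)
    heis_mulA heis_mul1 heis_mulr1 heis_mulV heis_mulrV.

(* ((Re X, Im X), rho, (theta, sigma)) *)
Notation lift_space R n :=
  ('rV[R]_n * 'rV[R]_n * R^o * ('rV[R]_n.+1 * 'rV[R]_n.+1 * R^o))%type.

Section lift.
Context {R : realType} {n : nat}.
Variables (M Minf : set 'rV[CC R]_n.+1) (F : 'rV[CC R]_n.+1 -> CC R).
Variables (Omega : 'rV[CC R]_n.+1 -> latticeL n -> int) (c : R).
Implicit Types q u v : lift_space R n.

Definition Xhom q : 'rV[CC R]_n.+1 :=
  \row_i (if unlift ord0 i is Some j then q.1.1.1 0 j +i* q.1.1.2 0 j else 1)%C.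

Definition Kpot q : R := - ln (r2 F (Xhom q)).

Definition z0 q : R := Num.sqrt ((q.1.2 + c) / (2 * pi)) * expR (Kpot q / 2).

(* (X, rho, theta, sigma) |-> (z, theta, sigma), a lift to T^*M_oo x R_sigma of
   the map to P *)
Definition Phi q : ('rV[R]_(dimN n) * R^o)%type :=
  (mkN ((z0 q)%:C%C *: Xhom q) q.2.1.1 q.2.1.2, q.2.2).

(* Phi is smooth on the domain below; its differential is computed
   componentwise by directional derivatives. *)
Definition dPhi q u : ('rV[R]_(dimN n) * R^o)%type :=
  (\row_j 'D_u (fun q' => (Phi q').1 0 j : R^o) q, 'D_u (fun q' => (Phi q').2) q).

Definition lift_dom : set (lift_space R n) :=
  [set q | [/\ M (Xhom q), 0 < q.1.2 & Nbar F Omega c Minf (Phi q)]].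

Definition glift q u v : R := gQK F Omega c (Phi q) (dPhi q u) (dPhi q v).

Definition heis_act (h : heis R n) q : lift_space R n :=
  (q.1, heis_mul h q.2).

Definition acts_by_isometries (S : set (heis R n)) : Prop :=
  forall h, S h -> forall q, lift_dom q ->
    lift_dom (heis_act h q) /\
    forall u v, glift (heis_act h q) ('d (heis_act h) q u) ('d (heis_act h) q v)
                = glift q u v.

Definition ncoef (i : 'I_n.+1) : set int :=
  [set g.2 0 i | g in Supp Minf Omega].

Definition gcd_set (A : set int) : nat :=
  xget 0%N [set d : nat | (forall m, A m -> (d %| m)%Z) /\
    forall e : nat, (forall m, A m -> (e %| m)%Z) -> (e %| d)%N].

Definition isom_subgroup : set (heis R n) :=
  [set h : heis R n | forall i, ncoef i <> [set 0] ->
     exists k : int, h.1.2 0 i = 2 * pi * k%:~R / (gcd_set (ncoef i))%:R].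

End lift.

(* Main.v *)
Require Import Defs.
From HB Require Import structures.
From mathcomp Require Import all_boot all_order all_algebra.
From mathcomp Require Import complex.
From mathcomp Require Import all_classical all_reals all_analysis.
From mathcomp Require Import ring lra zify.

Set Implicit Arguments.
Unset Strict Implicit.

Import Order.TTheory GRing.Theory Num.Theory numFieldNormedType.Exports.
Local Open Scope classical_set_scope.
Local Open Scope ring_scope.

(** All instanton corrections depend on the fibre coordinates theta only through
    the phases exp(i k theta_gamma) with gamma in the support of Omega.  A
    translation of the torus fibres by a vector t on which every theta_gamma
    takes values in 2 pi Z (a [fibre_period]) therefore leaves V^inst, A^inst,
    eta^inst, hence the omega_a, g_N, f and f_1, unchanged over M_oo.  When the
    charges are gamma = n_i d/dy_i, one has theta_gamma = n_i theta^i, so t is a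
    fibre period as soon as its theta^i-component lies in 2 pi Z / d_i whenever
    some n_i is nonzero, the other components being free
    ([isom_subgroup_period]).

    The only other place where theta enters the metric is the connection form
    eta, through d sigma - <theta, d theta> / 4 pi.  Translating theta by t adds
    - <t, d theta> / 4 pi to it, and the cocycle in the product of the
    Heisenberg group shifts d sigma by exactly the opposite amount, so that eta
    is invariant under left multiplication ([etaP_heis]).  Together these two
    facts show that the metric is preserved ([glift_heis]).

    The subgroup is proper because some charge in the support is nonzero: the
    support property forces |Z_gamma| > 0 ([Supp_neq0]), which excludes
    gamma = 0.  If n_i(gamma) <> 0 then theta^i = pi / d_i is not allowed. *)

(** * Fibre translations preserving the instanton corrections *)

Section Periods.
Context {R : realType} {n : nat}.
Implicit Types (F : 'rV[CC R]_n.+1 -> CC R) (p t u v : 'rV[R]_(dimN n)).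
Implicit Types (Omega : 'rV[CC R]_n.+1 -> latticeL n -> int).
Implicit Types (Minf : set 'rV[CC R]_n.+1).

Lemma expi_periodic (x : R) (m : int) : expi (x + 2 * pi * m%:~R) = expi x.
Proof.
have nat_case (y : R) (k : nat) : expi (y + 2 * pi * k%:R) = expi y.
  elim: k => [|k IH]; first by rewrite mulr0 addr0.
  rewrite -[RHS]IH -[k.+1]addn1 natrD mulrDr mulr1 addrA [2 * pi]mulr_natl.
  by rewrite /expi cosD2pi sinD2pi.
case: m => k; first exact: nat_case.
by rewrite NegzE mulrNz mulrN -[LHS](nat_case _ k.+1) -addrA addNr addr0.
Qed.

(** [lsubmx] selects the coordinates of the base, so [lsubmx t = 0] makes t
    tangent to the fibres of the projection to M. *)
Definition fibre_period Minf Omega t : Prop :=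
  lsubmx t = 0 /\
  forall g, Supp Minf Omega g -> exists m : int, theta g t = 2 * pi * m%:~R.

Lemma thetaD g p t : theta g (p + t) = theta g p + theta g t.
Proof.
rewrite /theta -big_split; apply: eq_bigr => i _ /=.
by rewrite /thtilde /thup !mxE; ring.
Qed.

Section Invariance.
Context Minf F Omega (c : R) t p.
Hypothesis t_period : fibre_period Minf Omega t.
Hypothesis pM : Minf (zc p).

Lemma zcD_period p' : zc (p' + t) = zc p'.
Proof.
case: t_period => t0 _; apply/rowP => j; rewrite !mxE /=.
have := congr1 (fun A : 'rV[R]_(n.+1 + n.+1) => A 0 (lshift n.+1 j)) t0.
have := congr1 (fun A : 'rV[R]_(n.+1 + n.+1) => A 0 (rshift n.+1 j)) t0.
by rewrite !mxE => -> ->; rewrite !addr0.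
Qed.

Lemma expiD_period g (k : nat) : Supp Minf Omega g ->
  expi (k%:R * theta g (p + t)) = expi (k%:R * theta g p).
Proof.
case: t_period => _ /[apply] -[m tm].
rewrite thetaD tm mulrDr -(expi_periodic (k%:R * theta g p) (k%:Z * m)).
by congr (expi (_ + _)); rewrite intrM; ring.
Qed.

Lemma Vinst_period g : Supp Minf Omega g -> Vinst F g (p + t) = Vinst F g p.
Proof.
move=> gS; rewrite /Vinst /absZ zcD_period.
by under eq_fun do rewrite expiD_period //.
Qed.

Lemma Ainst_period g u : Supp Minf Omega g ->
  Ainst F g (p + t) u = Ainst F g p u.
Proof.
move=> gS; rewrite /Ainst /dargZ /dZbar /dZ /absZ zcD_period.
by under eq_fun do rewrite expiD_period //.
Qed.

Lemma etainst_g_period g u : Supp Minf Omega g ->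
  etainst_g F g (p + t) u = etainst_g F g p u.
Proof.
move=> gS; rewrite /etainst_g /dargZ /dZbar /dZ /absZ zcD_period.
by under eq_fun do rewrite expiD_period //.
Qed.

(** Off the support the weight Omega vanishes, so the terms may differ there. *)
Lemma bps_sum_period (T S : latticeL n -> CC R) :
  (forall g, Supp Minf Omega g -> T g = S g) ->
  bps_sum Omega (p + t) T = bps_sum Omega p S.
Proof.
move=> TS; rewrite /bps_sum; congr (summability.sum _); apply/funext => g.
rewrite zcD_period; have [->|g0] := eqVneq (Omega (zc p) g) 0.
  by rewrite !mul0r.
by rewrite TS //; exists (zc p).
Qed.

Lemma omega12_period : omega12 F Omega (p + t) = omega12 F Omega p.
Proof.
apply/funext => u; apply/funext => v; rewrite /omega12 /dZ zcD_period.
apply: (f_equal2 +%R); first by [].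
apply: bps_sum_period => g gS.
by rewrite /wedge 2!(Ainst_period _ gS) (Vinst_period gS).
Qed.

Lemma omega1_period : omega1 F Omega (p + t) = omega1 F Omega p.
Proof. by rewrite /omega1 omega12_period. Qed.

Lemma omega2_period : omega2 F Omega (p + t) = omega2 F Omega p.
Proof. by rewrite /omega2 omega12_period. Qed.

Lemma omega3_period : omega3 F Omega (p + t) = omega3 F Omega p.
Proof.
apply/funext => u; apply/funext => v; rewrite /omega3 /dZbar /dZ zcD_period.
apply/(congr1 (@complex.Re R))/(f_equal2 +%R); first by [].
apply: bps_sum_period => g gS.
by rewrite /wedge 2!(Ainst_period _ gS) (Vinst_period gS).
Qed.

Lemma gN_period : gN F Omega (p + t) = gN F Omega p.
Proof. by rewrite /gN /I3mx omega1_period omega2_period omega3_period. Qed.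

Lemma Vvec_period : Vvec (p + t) = Vvec p.
Proof. by rewrite /Vvec zcD_period. Qed.

Lemma bps_sum_etainst_period u :
  bps_sum Omega (p + t) (fun g => etainst_g F g (p + t) u) =
  bps_sum Omega p (fun g => etainst_g F g p u).
Proof. by apply: bps_sum_period => g; exact: etainst_g_period. Qed.

Lemma etainst_period u : etainst F Omega (p + t) u = etainst F Omega p u.
Proof.
rewrite /etainst gN_period Vvec_period /gMN zcD_period.
by rewrite bps_sum_etainst_period.
Qed.

Lemma ffctn_period : ffctn F Omega c (p + t) = ffctn F Omega c p.
Proof. by rewrite /ffctn zcD_period Vvec_period bps_sum_etainst_period. Qed.

Lemma f1fctn_period : f1fctn F Omega c (p + t) = f1fctn F Omega c p.
Proof. by rewrite /f1fctn zcD_period Vvec_period etainst_period. Qed.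

Lemma Nprime_period : Nprime F Omega c Minf p -> Nprime F Omega c Minf (p + t).
Proof.
rewrite /Nprime /= => -[_ f0 f10 gX0]; rewrite /Xvec zcD_period Vvec_period.
by rewrite ffctn_period f1fctn_period gN_period.
Qed.

End Invariance.
End Periods.

(** * Directional derivatives *)

(** Continuity of [zc], reduced to the real and imaginary parts of each entry
    because the norm of R[i] takes its values in R[i]. *)
Lemma near_zc {R : realType} {n : nat} (U : set 'rV[CC R]_n.+1)
    (p : 'rV[R]_(dimN n)) :
  open U -> U (zc p) -> \forall p' \near p, U (zc p').
Proof.
move=> Uo Up; have [P /= Pnbhs PU] : nbhs (zc p) U by exact: open_nbhs_nbhs.
have entry (j : 'I_n.+1) : \forall p' \near p, P ord0 j (zc p' ord0 j).
  have /nbhs_ballP[e /= e0 eP] := Pnbhs ord0 j.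
  (* Radii in R[i] are complex numbers; being positive, they are real. *)
  have eE : e = (complex.Re e)%:C%C by apply/esym/RRe_real/gtr0_real.
  have r0 : 0 < complex.Re e by rewrite -ltcR -eE.
  have d0 : 0 < complex.Re e / 2 by rewrite divr_gt0.
  have near_coord (k : 'I_(dimN n)) :
      \forall p' \near p,
        `|p 0 k - (p' : 'rV[R]_(dimN n)) 0 k| < complex.Re e / 2.
    have /cvgrPdist_lt : (fun p' : 'rV[R]_(dimN n) => p' 0 k) p' @[p' --> p]
        --> p 0 k.
      exact: (@coord_continuous R 1 (dimN n) 0 k p).
    by apply.
  near=> p'; apply: eP; rewrite /ball /= /ball_ eE.
  rewrite normc_def ltcR !mxE /= -[ltRHS](gtr0_norm r0).
  rewrite -sqrtr_sqr ltr_sqrt ?exprn_gt0 //.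
  have small (x : R) :
      `|x| < complex.Re e / 2 -> x ^+ 2 < complex.Re e ^+ 2 / 2.
    by rewrite -[x ^+ 2]real_normK ?num_real //; have := normr_ge0 x; nra.
  rewrite [ltRHS]splitr; apply: ltrD; apply: small; near: p';
    exact: near_coord.
have : \forall p' \near p, forall j, P ord0 j (zc p' ord0 j).
  exact: (filter_forall _ entry).
apply: filterS => p' Pp'; apply: PU => i j; rewrite ord1; exact: Pp'.
Unshelve. all: end_near. Qed.

(** Only difference quotients are compared, since a derivative is by definition
    their limit.  Used for functions that differ by a constant along the orbits
    of a translation or of the Heisenberg action. *)
Lemma derive_shift_line {R : realType} {V V' W : normedModType R}
    (f : V -> W) (g : V' -> W) (x u : V) (y v : V') :
  (forall s : R, f (s *: u + x) - f x = g (s *: v + y) - g y) ->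
  'D_u f x = 'D_v g y.
Proof.
move=> fg; rewrite /derive.
by under eq_fun do rewrite /= fg.
Qed.

Lemma derive_affine_line {R : realType} {V W : normedModType R}
    (f : V -> W) (x u : V) (l : W) :
  (forall s : R, f (s *: u + x) - f x = s *: l) -> 'D_u f x = l.
Proof.
move=> fl; rewrite /derive; apply: cvg_lim; first exact: norm_hausdorff.
apply: cvg_near_cst; near=> s; rewrite /= fl scalerA mulVf ?scale1r //.
by near: s; exact: nbhs_dnbhs_neq.
Unshelve. all: end_near. Qed.

Lemma fst_continuous (A B : topologicalType) : continuous (@fst A B).
Proof. by case=> a b; exact: cvg_fst. Qed.

Lemma snd_continuous (A B : topologicalType) : continuous (@snd A B).
Proof. by case=> a b; exact: cvg_snd. Qed.

(** * The differential of the Heisenberg action *)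

Section Heis.
Context {R : realType} {n : nat}.
Implicit Types (h : heis R n) (q u v : lift_space R n).

(** The linear part of left multiplication by h, which is an affine map. *)
Definition heis_act_tangent h u : lift_space R n :=
  (u.1, (u.2.1, u.2.2 + (4 * pi)^-1 * symp h.1 u.2.1)).

Lemma sympZr (s : R) (x y : 'rV[R]_n.+1 * 'rV[R]_n.+1) :
  symp x (s *: y) = s * symp x y.
Proof.
by rewrite /symp mulr_sumr; apply: eq_bigr => i _; rewrite !mxE; ring.
Qed.

Lemma heis_actD h q u s :
  heis_act h (s *: u + q) = s *: heis_act_tangent h u + heis_act h q.
Proof.
rewrite /heis_act /heis_act_tangent /heis_mul /=; congr (_, (_, _)) => /=.
  by rewrite addrCA.
by rewrite sympDr sympZr /GRing.scale /=; ring.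
Qed.

Lemma heis_act_tangent_linear h : linear (heis_act_tangent h).
Proof.
move=> s u v; rewrite /heis_act_tangent; congr (_, (_, _)) => /=.
by rewrite sympDr sympZr /GRing.scale /=; ring.
Qed.

HB.instance Definition _ h :=
  GRing.isLinear.Build R _ _ _ (heis_act_tangent h) (heis_act_tangent_linear h).

Lemma symp_continuous (x : 'rV[R]_n.+1 * 'rV[R]_n.+1) :
  continuous (symp x : 'rV[R]_n.+1 * 'rV[R]_n.+1 -> R).
Proof.
move=> y; apply: (@cvg_big _ _ +%R); first exact: add_continuous.
move=> i _; apply: cvgB; apply: cvgMl_tmp.
  exact: (continuous_comp (@snd_continuous _ _ y)
                          (@coord_continuous R 1 n.+1 0 i y.2)).
exact: (continuous_comp (@fst_continuous _ _ y)
                        (@coord_continuous R 1 n.+1 0 i y.1)).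
Qed.

Lemma heis_act_tangent_continuous h :
  continuous (heis_act_tangent h : lift_space R n -> lift_space R n).
Proof.
move=> u.
have thetac : v.2.1 @[v --> u] --> u.2.1.
  exact: (continuous_comp (@snd_continuous _ _ u) (@fst_continuous _ _ u.2)).
have sigmac : v.2.2 @[v --> u] --> u.2.2.
  exact: (continuous_comp (@snd_continuous _ _ u) (@snd_continuous _ _ u.2)).
have sympc : symp h.1 v.2.1 @[v --> u] --> symp h.1 u.2.1.
  exact: (continuous_comp thetac (@symp_continuous h.1 _)).
have cocyclec : v.2.2 + (4 * pi)^-1 * symp h.1 v.2.1 @[v --> u] -->
    u.2.2 + (4 * pi)^-1 * symp h.1 u.2.1.
  by apply: cvgD; first exact: sigmac; exact: cvgMl_tmp sympc.
exact: (cvg_pair (@fst_continuous _ _ u) (cvg_pair thetac cocyclec)).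
Qed.

Lemma diff_heis_act h q :
  'd (heis_act h : lift_space R n -> lift_space R n) q = heis_act_tangent h
  :> (_ -> _).
Proof.
apply: diff_unique; first exact: heis_act_tangent_continuous.
(* The remainder of an affine map vanishes identically. *)
apply/eqaddoP => e e0; near=> u; rewrite [X in `|X|](_ : _ = 0) ?normr0.
  by rewrite mulr_ge0 // ltW.
have := heis_actD h q u 1; rewrite !scale1r => actD.
rewrite -[LHS]/(heis_act h (u + q) - (heis_act h q + heis_act_tangent h u)).
by rewrite actD [heis_act h q + _]addrC subrr.
Unshelve. all: end_near. Qed.
End Heis.

(** * Invariance of the lifted metric *)

Section Lift.
Context {R : realType} {n : nat}.
Context (M Minf : set 'rV[CC R]_n.+1) (F : 'rV[CC R]_n.+1 -> CC R).
Context (Omega : 'rV[CC R]_n.+1 -> latticeL n -> int) (c : R).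
Implicit Types (h : heis R n) (q u v : lift_space R n) (p t : 'rV[R]_(dimN n)).

Definition fibre_shift h : 'rV[R]_(dimN n) := mkN 0 h.1.1 h.1.2.

Lemma PhiD_shift h q :
  (Phi F c (heis_act h q)).1 = (Phi F c q).1 + fibre_shift h.
Proof.
rewrite /Phi /fibre_shift /mkN /= !add_row_mx [_ + h.1.1]addrC [_ + h.1.2]addrC.
by rewrite !map_mx0 !addr0.
Qed.

Lemma dPhi_shift h q u :
  (dPhi F c (heis_act h q) (heis_act_tangent h u)).1 = (dPhi F c q u).1.
Proof.
apply/rowP => j; rewrite mxE [RHS]mxE; apply: derive_shift_line => s.
rewrite -(heis_actD h q u s) (PhiD_shift h (s *: u + q)) (PhiD_shift h q).
move: (Phi F c (s *: u + q)).1 (Phi F c q).1 => A B.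
by rewrite [(A + _) 0 j]mxE [(B + _) 0 j]mxE opprD addrACA subrr addr0.
Qed.

Lemma dPhi_sigma q u : (dPhi F c q u).2 = u.2.2.
Proof. by apply: derive_affine_line => s /=; rewrite addrK. Qed.

Lemma thtilde_mkN (z : 'rV[CC R]_n.+1) a b : thtilde (mkN z a b) = a.
Proof. by rewrite /thtilde /mkN row_mxKr row_mxKl. Qed.

Lemma thup_mkN (z : 'rV[CC R]_n.+1) a b : thup (mkN z a b) = b.
Proof. by rewrite /thup /mkN !row_mxKr. Qed.

Lemma dPhi_thtilde q u : thtilde (dPhi F c q u).1 = u.2.1.1.
Proof.
have coordE q' j : (Phi F c q').1 0 (rshift _ (lshift _ j)) = q'.2.1.1 0 j.
  rewrite -[in RHS](thtilde_mkN ((z0 F c q')%:C%C *: Xhom q')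
                      q'.2.1.1 q'.2.1.2).
  by rewrite [RHS]mxE [RHS]mxE.
apply/rowP => j; rewrite [LHS]mxE mxE [LHS]mxE; apply: derive_affine_line => s.
by rewrite !coordE !mxE addrK.
Qed.

Lemma dPhi_thup q u : thup (dPhi F c q u).1 = u.2.1.2.
Proof.
have coordE q' j : (Phi F c q').1 0 (rshift _ (rshift _ j)) = q'.2.1.2 0 j.
  rewrite -[in RHS](thup_mkN ((z0 F c q')%:C%C *: Xhom q') q'.2.1.1 q'.2.1.2).
  by rewrite [RHS]mxE [RHS]mxE.
apply/rowP => j; rewrite [LHS]mxE mxE [LHS]mxE; apply: derive_affine_line => s.
by rewrite !coordE !mxE addrK.
Qed.

(** Invariance of f over M_oo can be differentiated because M_oo is open. *)
Lemma D_ffctn_period p t w :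
  open Minf -> fibre_period Minf Omega t -> Minf (zc p) ->
  'D_w (ffctn F Omega c : _ -> R^o) (p + t) =
  'D_w (ffctn F Omega c : _ -> R^o) p.
Proof.
move=> Mo tP pM.
transitivity ('D_w (fun p' => ffctn F Omega c (p' + t) : R^o) p).
  by apply: derive_shift_line => s; rewrite addrA.
apply: near_eq_derive; near=> p'; apply: ffctn_period; first exact: tP.
by near: p'; exact: near_zc.
Unshelve. all: end_near. Qed.

(** The term <theta, d theta> / 4 pi changes by <h, d theta> / 4 pi under the
    shift of theta, which is the change of d sigma produced by the Heisenberg
    cocycle. *)
Lemma etaP_heis h q u :
  fibre_period Minf Omega (fibre_shift h) -> Minf (zc (Phi F c q).1) ->
  etaP F Omega (Phi F c (heis_act h q))
    (dPhi F c (heis_act h q) (heis_act_tangent h u)) =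
  etaP F Omega (Phi F c q) (dPhi F c q u).
Proof.
move=> hP pM; rewrite /etaP PhiD_shift dPhi_shift (zcD_period hP _).
rewrite (etainst_period _ hP pM); congr (_ + _).
rewrite dPhi_thtilde dPhi_thup !dPhi_sigma -!PhiD_shift !thtilde_mkN !thup_mkN.
rewrite /= -/(symp (h.1 + q.2.1) u.2.1) -/(symp q.2.1 u.2.1) sympDl.
by ring.
Qed.

(** Apart from eta, the metric on P sees only the point and the tangent vectors
    of N. *)
Lemma gQK_period t (x x' a a' b b' : 'rV[R]_(dimN n) * R^o) : open Minf ->
  fibre_period Minf Omega t -> Minf (zc x.1) ->
  x'.1 = x.1 + t -> a'.1 = a.1 -> b'.1 = b.1 ->
  etaP F Omega x' a' = etaP F Omega x a ->
  etaP F Omega x' b' = etaP F Omega x b ->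
  gQK F Omega c x' a' b' = gQK F Omega c x a b.
Proof.
move=> Mo tP xM xx aa bb ea eb.
rewrite /gQK /gP /theta0P /theta1P /theta2P /theta3P /Xvec ea eb xx aa bb.
rewrite 2!(D_ffctn_period _ Mo tP xM) (Vvec_period _ tP).
rewrite (ffctn_period _ _ tP xM) (f1fctn_period _ _ tP xM).
rewrite (gN_period _ tP xM).
by rewrite (omega1_period _ tP xM) (omega2_period _ tP xM).
Qed.

Lemma glift_heis h q u v : open Minf ->
  fibre_period Minf Omega (fibre_shift h) -> Minf (zc (Phi F c q).1) ->
  glift F Omega c (heis_act h q) (heis_act_tangent h u) (heis_act_tangent h v)
  = glift F Omega c q u v.
Proof.
move=> Mo hP pM; apply: (gQK_period Mo hP pM).
- exact: PhiD_shift.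
- exact: dPhi_shift.
- exact: dPhi_shift.
- exact: etaP_heis.
- exact: etaP_heis.
Qed.

Lemma lift_dom_heis h q : fibre_period Minf Omega (fibre_shift h) ->
  lift_dom M Minf F Omega c q -> lift_dom M Minf F Omega c (heis_act h q).
Proof.
move=> hP [qM rho0 [qN z0]]; split; [exact: qM|exact: rho0|].
rewrite /Nbar /mkset (PhiD_shift h q) (zcD_period hP _); split; last exact: z0.
by apply: (Nprime_period hP _ qN); case: qN.
Qed.

End Lift.

(** * The subgroup of fibre periods *)

Section Subgroup.
Context {R : realType} {n : nat}.
Context (Minf : set 'rV[CC R]_n.+1) (F : 'rV[CC R]_n.+1 -> CC R).
Context (Omega : 'rV[CC R]_n.+1 -> latticeL n -> int).

Lemma isom_subgroup_closed :
  group_closed (mem (isom_subgroup Minf Omega : set (heis R n))).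
Proof.
split; first by rewrite inE => i _; exists 0; rewrite mulr0 mul0r /= mxE.
move=> a b; rewrite !inE => aS bS i iS.
have [k ak] := aS i iS; have [l bl] := bS i iS.
by exists (k - l); rewrite /= mxE mxE ak bl rmorphB /= -mulrBl -mulrBr.
Qed.

(** The gcd of an arbitrary set of integers exists: it is the lcm of the common
    divisors, of which there are finitely many once the set contains a nonzero
    element m0, since they are all at most |m0|. *)
Lemma gcd_set_dvd (A : set int) (m : int) : A m -> (gcd_set A %| m)%Z.
Proof.
rewrite /gcd_set; set gcdP := [set d : nat | _].
suff /(xgetPex 0%N)[dvdA _] : exists d, gcdP d by exact: dvdA.
have [A0|/existsNP[m0 /not_implyP[Am0 /eqP m00]]] :=
  pselect (forall x, A x -> x = 0).
  by exists 0%N; split=> [x /A0 ->|e _]; rewrite ?dvdz0 ?dvdn0.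
pose common (e : nat) := `[< forall x, A x -> (e %| x)%Z >].
exists (\big[lcmn/1%N]_(e < `|m0|%N.+1 | common e) e)%N; split=> [x Ax|e eA].
  rewrite dvdzE; apply/dvdn_biglcmP => e /asboolP eA.
  by have := eA x Ax; rewrite dvdzE.
have e_le : (e < `|m0|%N.+1)%N.
  by rewrite ltnS dvdn_leq ?absz_gt0 //; have := eA m0 Am0; rewrite dvdzE.
by apply: (@biglcmn_sup _ (Ordinal e_le)) => //; exact/asboolP.
Qed.

Lemma gcd_set_neq0 (A : set int) (m : int) :
  A m -> m != 0 -> gcd_set A != 0%N.
Proof.
move=> /gcd_set_dvd dvdm; apply: contra_neq => A0.
by apply/eqP; move: dvdm; rewrite A0 dvd0z.
Qed.

Lemma ncoef_neq0 g i : Supp Minf Omega g -> g.2 0 i != 0 ->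
  ncoef Minf Omega i (g.2 0 i) /\ ncoef Minf Omega i <> [set 0].
Proof.
move=> gS gi; have gA : ncoef Minf Omega i (g.2 0 i) by exists g.
by split=> // n0; move: gA; rewrite n0 => /= g0; rewrite g0 eqxx in gi.
Qed.

(** Each summand n_i theta^i of theta_gamma is in 2 pi Z, since d_i divides
    n_i. *)
Lemma isom_subgroup_period (h : heis R n) :
  (forall g : latticeL n, Supp Minf Omega g -> g.1 = 0) ->
  isom_subgroup Minf Omega h -> fibre_period Minf Omega (fibre_shift h).
Proof.
move=> hSupp hS; split.
  by rewrite /fibre_shift /mkN row_mxKl !map_mx0 row_mx0.
move=> g gS; rewrite /theta thtilde_mkN thup_mkN (hSupp g gS).
apply: (big_ind (fun x : R => exists m : int, x = 2 * pi * m%:~R)).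
- by exists 0; rewrite mulr0.
- by move=> x y [k ->] [l ->]; exists (k + l); rewrite intrD; ring.
move=> i _; rewrite mxE mul0r add0r; have [->|gi] := eqVneq (g.2 0 i) 0.
  by exists 0; rewrite mulr0z mul0r mulr0.
have [gA iS] := ncoef_neq0 gS gi; have [k ->] := hS i iS.
have d0 : (gcd_set (ncoef Minf Omega i))%:R != 0 :> R.
  by rewrite pnatr_eq0 (gcd_set_neq0 gA gi).
have /dvdzP[m gm] := gcd_set_dvd gA; exists (m * k); rewrite gm.
by rewrite !intrM; field.
Qed.

(** The norm to which the support property is applied in [Supp_neq0]. *)
Lemma l1_is_norm : is_norm (fun v : 'rV[R]_n.+1 * 'rV[R]_n.+1 =>
  \sum_i `|v.1 0 i| + \sum_i `|v.2 0 i|).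
Proof.
split=> [v w|a v|v /eqP].
- rewrite addrACA; apply: lerD; rewrite -big_split; apply: ler_sum => i _;
    by rewrite mxE ler_normD.
- by rewrite mulrDr !mulr_sumr; congr (_ + _); apply: eq_bigr => i _;
    rewrite mxE normrM.
rewrite paddr_eq0 ?sumr_ge0 // !psumr_eq0 // => /andP[/allP v1 /allP v2].
case: v v1 v2 => v w /= v1 v2; congr pair; apply/rowP => i; rewrite mxE.
  by apply/normr0_eq0/eqP/v1; rewrite mem_index_enum.
by apply/normr0_eq0/eqP/v2; rewrite mem_index_enum.
Qed.

(** The support property at a point of M_oo reads C |gamma| < |Z_gamma|, which
    fails for gamma = 0 as both sides vanish. *)
Lemma Supp_neq0 g :
  mutually_local_BPS Minf F Omega -> Supp Minf Omega g -> g != 0.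
Proof.
move=> hOmega [z zM gz]; apply/eqP => g0.
have zMs : [set z] `<=` Minf by move=> _ ->.
have [C C0 /(_ z g erefl gz)] :=
  bps_support hOmega (@compact_set1 _ z) zMs l1_is_norm.
have -> : Zfun F g z = 0.
  by rewrite g0; apply: big1 => i _; rewrite !mxE !mul0r addr0.
rewrite ComplexField.Normc.normc0 pmulr_rlt0 // ltNge.
by rewrite addr_ge0 // sumr_ge0.
Qed.

Lemma isom_subgroup_proper : mutually_local_BPS Minf F Omega ->
  (forall g : latticeL n, Supp Minf Omega g -> g.1 = 0) ->
  Supp Minf Omega !=set0 ->
  isom_subgroup Minf Omega <> [set: heis R n].
Proof.
move=> hOmega hSupp [g gS] full.
have [i gi] : exists i, g.2 0 i != 0.
  apply/existsP; rewrite -negb_forall; apply/negP => /forallP g20.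
  have /eqP := Supp_neq0 hOmega gS; apply.
  rewrite [g]surjective_pairing (hSupp g gS); congr pair; apply/rowP => i.
  by rewrite mxE; apply/eqP.
have [gA iS] := ncoef_neq0 gS gi.
pose d : R := (gcd_set (ncoef Minf Omega i))%:R.
have d0 : d != 0 by rewrite pnatr_eq0 (gcd_set_neq0 gA gi).
(* Membership of pi / d_i in 2 pi Z / d_i would make 1 an even integer. *)
pose h : heis R n := ((0, const_mx (pi / d)), 0).
have : isom_subgroup Minf Omega h by rewrite full.
move=> /(_ i iS)[k]; rewrite /= mxE -/d.
have pi0 : (pi : R) != 0 by rewrite gt_eqF ?pi_gt0.
have cancel (a x : R) : a != 0 -> a = 2 * a * x -> 1 = 2 * x.
  by move=> a0 E; apply: (mulfI a0); rewrite mulr1 {1}E; ring.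
move=> /(mulIf (invr_neq0 d0))/(cancel _ _ pi0) two_k.
have : (1 : int)%:~R = (2 * k)%:~R :> R by rewrite intrM -two_k.
by move=> /intr_inj; lia.
Qed.

End Subgroup.

Theorem corollary5p7 (R : realType) (n : nat)
  (M Minf : set 'rV[CC R]_n.+1) (F : 'rV[CC R]_n.+1 -> CC R)
  (Omega : 'rV[CC R]_n.+1 -> latticeL n -> int) (c : R)
  (hM : CASK_domain M F)
  (hMinf : cask_end M Minf)
  (hOmega : mutually_local_BPS Minf F Omega)
  (hcompatible : compatible F Omega Minf)
  (hSupp : forall g : latticeL n, Supp Minf Omega g -> g.1 = 0)
  (hOmega0 : Supp Minf Omega !=set0) :
  [/\ group_closed (mem (isom_subgroup Minf Omega)),
      isom_subgroup Minf Omega <> [set: heis R n] &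
      acts_by_isometries M Minf F Omega c (isom_subgroup Minf Omega)].
Proof.
split; first exact: isom_subgroup_closed.
  exact: (isom_subgroup_proper hOmega).
move=> h /(isom_subgroup_period hSupp) hP q qD.
split=> [|u v]; first exact: lift_dom_heis.
have qM : Minf (zc (Phi F c q).1) by case: qD => _ _ [[]].
rewrite (diff_heis_act h q).
exact: (glift_heis u v (end_open hMinf) hP qM).
Qed.
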